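(* For all integers $d,m\ge1$ there exists a constant $C_{m,d}>0$ depending only on $m,d$ such that for all $B>0$ and $n\ge1$, \[{}^*\sigma^{\mathrm{ad}}_n(\mathcal F_{d,m,B},S_L,D_{\mathrm{abs}})\le O_{m,d}\Big(\min\big\{Bn^{-m/d},\ \exp(C_{m,d}Bn^{-m/d})\,B\,n^{-1/2-m/d}\big\}\Big).\]
   Context: Let $\mathcal X=[0,1]^d$ with Lebesgue measure. For bounded measurable $f:\mathcal X\to\mathbb R$ let $L_f=\log\int_{\mathcal X}e^{f(x)}dx$. For $f\in C^m(\mathcal X)$, $\|f\|_{C^m}=\sup_{\alpha\in\mathbb N_0^d,|\alpha|_1\le m}\|\partial^\alpha f\|_\infty$, and $\mathcal F_{d,m,B}=\{f\in C^m(\mathcal X):\|f\|_{C^m}\le B\}$. $S_L(f)=L_f$, $D_{\mathrm{abs}}(a,b)=|a-b|$. $\mathcal A^{\mathrm{ad}}_n$ is the set of maps $\tilde S=\phi\circ N$ from functions to $\mathbb R$ with $N(f)=(f(x_1),f(x_2),\dots,f(x_n))$, where each $x_k\in\mathcal X$ may depend on $f(x_1),\dots,f(x_{k-1})$, and $\phi:\mathbb R^n\to\mathbb R$ arbitrary. The stochastic adaptive minimax error is ${}^*\sigma^{\mathrm{ad}}_n(\mathcal F,S,D)=\inf\sup_{f\in\mathcal F}\mathbb E_{\omega\sim P_\Omega}D(S(f),\tilde S(\omega)(f))$, where the infimum is over probability spaces $(\Omega,P_\Omega)$ and random variables $\tilde S:\Omega\to\mathcal A^{\mathrm{ad}}_n$.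 Asymptotic notation: $g\le O_{m,d}(h)$ means that for all $m,d$ there is $C'_{m,d}>0$ with $g\le C'_{m,d}h$ for all $B>0$ and all $n\ge1$. *)

(* Defs.v *)
From HB Require Import structures.
From mathcomp Require Import all_boot all_order all_algebra.
From mathcomp Require Import all_classical all_reals all_analysis.
Set Implicit Arguments. Unset Strict Implicit. Unset Printing Implicit Defensive.
Import Order.TTheory GRing.Theory Num.Theory.
Import numFieldNormedType.Exports.
Local Open Scope classical_set_scope.
Local Open Scope ring_scope.

Section Defs.
Variable R : realType.

Definition cube (d : nat) : set 'rV[R]_d :=
  [set x | forall j : 'I_d, 0 <= x ord0 j <= 1].

Definition dquot d (j : 'I_d) (g : 'rV[R]_d -> R) (x : 'rV[R]_d) : R -> R :=
  fun h => h^-1 * (g (x + h *: delta_mx ord0 j) - g x).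

(* Filter h -> 0, h <> 0, with x + h e_j staying in the cube
   (one-sided derivatives at the boundary of X). *)
Definition dfilter d (j : 'I_d) (x : 'rV[R]_d) : set_system R :=
  within [set h : R | cube (x + h *: delta_mx ord0 j)] (0 : R)^'.

Definition pderiv d (j : 'I_d) (g : 'rV[R]_d -> R) (x : 'rV[R]_d) : R :=
  lim (dquot j g x @ dfilter j x).

Definition pderivable d (j : 'I_d) (g : 'rV[R]_d -> R) (x : 'rV[R]_d) : Prop :=
  cvg (dquot j g x @ dfilter j x).

(* Iterated partial derivative along a list of directions
   (a multi-index alpha with |alpha|_1 = size s, in some order). *)
Fixpoint pderivs d (s : seq 'I_d) (g : 'rV[R]_d -> R) : 'rV[R]_d -> R :=
  match s with
  | [::] => g
  | j :: s' => pderiv j (pderivs s' g)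
  end.

Definition Cm (d m : nat) (f : 'rV[R]_d -> R) : Prop :=
  (forall (s : seq 'I_d) (j : 'I_d) (x : 'rV[R]_d),
      (size s < m)%N -> cube x -> pderivable j (pderivs s f) x) /\
  (forall s : seq 'I_d, (size s <= m)%N ->
      {within @cube d, continuous (pderivs s f)}).

Definition Fclass (d m : nat) (B : R) : set ('rV[R]_d -> R) :=
  [set f | @Cm d m f /\
     forall (s : seq 'I_d) (x : 'rV[R]_d),
       (size s <= m)%N -> cube x -> `|pderivs s f x| <= B].

(* Integral over X = [0,1]^d with respect to Lebesgue measure, written as
   the iterated integral over the coordinates (Fubini).
   cube_int_aux k g x integrates coordinates 0..k-1 over [0,1], the
   remaining coordinates being taken from x. *)
Definition setcoord d (x : 'rV[R]_d) (k : nat) (t : R) : 'rV[R]_d :=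
  \row_(j < d) (if (j : nat) == k then t else x ord0 j).

Fixpoint cube_int_aux d (k : nat) (g : 'rV[R]_d -> R) (x : 'rV[R]_d) : R :=
  match k with
  | 0 => g x
  | k'.+1 => Rintegral lebesgue_measure `[0%R, 1%R]
               (fun t => cube_int_aux k' g (setcoord x k' t))
  end.

Definition cube_int d (g : 'rV[R]_d -> R) : R := cube_int_aux d g 0.

Definition logpart d (f : 'rV[R]_d -> R) : R := ln (cube_int (fun x => expR (f x))).

(* Deterministic adaptive algorithm with n function evaluations:
   the k-th node is [node (f(x_1),...,f(x_{k-1}))], and the output is
   [out (f(x_1),...,f(x_n))]. *)
Record adaptive_alg (d : nat) := AdaptiveAlg {
  node : seq R -> 'rV[R]_d;
  out : seq R -> R }.

Definition admissible d (A : adaptive_alg d) : Prop :=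
  forall v : seq R, cube (node A v).

Fixpoint info d (A : adaptive_alg d) (f : 'rV[R]_d -> R) (k : nat) : seq R :=
  match k with
  | 0 => [::]
  | k'.+1 => let v := info A f k' in rcons v (f (node A v))
  end.

Definition run d (n : nat) (A : adaptive_alg d) (f : 'rV[R]_d -> R) : R :=
  out A (info A f n).

Definition worst_err d (n : nat) (F : set ('rV[R]_d -> R))
    (dO : measure_display) (O : measurableType dO) (P : probability O R)
    (S : O -> adaptive_alg d) : \bar R :=
  ereal_sup [set (\int[P]_(w in [set: O]) (`|logpart f - run n (S w) f|)%:E)%E
            | f in F].

Definition sigma_ad d (n : nat) (F : set ('rV[R]_d -> R)) : \bar R :=
  ereal_inf [set e | exists (dO : measure_display) (O : measurableType dO)
                            (P : probability O R) (S : O -> adaptive_alg d),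
     (forall w, admissible (S w)) /\
     (forall f, F f -> measurable_fun [set: O] (fun w => run n (S w) f)) /\
     e = worst_err n F P S].

End Defs.

(* Main.v *)
Require Import Defs.
From HB Require Import structures.
From mathcomp Require Import all_boot all_order all_algebra.
From mathcomp Require Import all_classical all_reals all_analysis.
From mathcomp Require Import ring lra zify.
Set Implicit Arguments.
Unset Strict Implicit.
Unset Printing Implicit Defensive.
Import Order.TTheory GRing.Theory Num.Theory.
Import numFieldNormedType.Exports.
Local Open Scope classical_set_scope.
Local Open Scope ring_scope.

(** Two functions of the class that agree on a uniform grid of [p ^ d <= n]
    points differ by at most [delta = O(B n^(-m/d))] on the cube: comparing
    Taylor and Lagrange polynomials gives this along a line, and the estimate
    propagates from one coordinate to the next.  Any [g] of the class that
    interpolates the observed values of [f] therefore satisfies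
    [|L_f - L_g| <= delta], which is the first bound.

    For the second bound, [L_f - L_g = ln E[exp (f - g)]] where the expectation
    is over the density proportional to [exp g].  Half of the evaluations give
    [g], the others estimate this expectation by Monte Carlo; as [exp (f - g)]
    lies between [exp (-delta)] and [exp delta], the standard deviation is
    [O(delta exp delta n^(-1/2))] and [ln] is [exp delta]-Lipschitz there.

    Since only upper bounds are needed, the sampling density is discretised
    to [K] equiprobable atoms of a fine grid, with an error made as small as
    desired uniformly over the class.  The probability space is then the finite
    uniform space of maps ['I_N -> 'I_K]. *)

(** * Taylor expansion and interpolation on a segment *)

Section Segment.
Variables (R : realType) (a b : R).
Implicit Types (m k l : nat) (f df : R -> R) (h g : nat -> R -> R).
Implicit Types (M t x y : R) (u : nat -> R).

Lemma mean_value_le f df M t x : a <= t <= b -> a <= x <= b ->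
  {within `[a, b], continuous f} ->
  (forall y, a < y < b -> is_derive y 1 f (df y)) ->
  (forall y, a <= y <= b -> `|y - t| <= `|x - t| -> `|df y| <= M) ->
  `|f x - f t| <= M * `|x - t|.
Proof.
move=> t_ab x_ab f_cont f_derive df_le.
have mean_value (u v : R) : a <= u -> v <= b -> u <= v ->
    exists2 y, u <= y <= v & f v - f u = df y * (v - u).
  move=> au vb uv; have [||y y_uv fE] := @MVT_segment R f df u v uv.
  - by move=> y; rewrite in_itv /= => /andP[uy yv]; apply: f_derive; lra.
  - apply: continuous_subspaceW f_cont => y /=.
    by rewrite !in_itv /= => /andP[uy yv]; lra.
  - by exists y => //; move: y_uv; rewrite in_itv.
have [tx|/ltW xt] := leP t x.
- have [|||y y_tx ->] // := mean_value t x; [lra|lra|].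
  rewrite normrM ler_wpM2r //; apply: df_le; first by lra.
  by rewrite !ger0_norm; lra.
- have [|||y y_xt] // := mean_value x t; [lra|lra|].
  rewrite distrC => ->; rewrite [`|x - t|]distrC normrM ler_wpM2r //.
  apply: df_le; first by lra.
  by rewrite !ler0_norm; lra.
Qed.

Definition deriv_chain m h : Prop := forall k, (k < m)%N ->
  {within `[a, b], continuous (h k)} /\
  forall t, a < t < b -> is_derive t 1 (h k) (h k.+1 t).

Lemma deriv_chain_shift m h : deriv_chain m.+1 h -> deriv_chain m (h \o S).
Proof. by move=> h_chain k km; exact: (h_chain k.+1). Qed.

Lemma deriv_chainB m h g : deriv_chain m h -> deriv_chain m g ->
  deriv_chain m (fun k => h k - g k).
Proof.
move=> h_chain g_chain k km.
have [h_cont h_derive] := h_chain k km; have [g_cont g_derive] := g_chain k km.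
split=> [|t t_ab]; first exact: within_continuousB.
by have ? := h_derive t t_ab; have ? := g_derive t t_ab; exact: is_deriveB.
Qed.

Definition taylor_poly m h t : {poly R} :=
  \sum_(k < m) (h k t / k`!%:R) *: ('X - t%:P) ^+ k.

Lemma size_taylor_poly m h t : (size (taylor_poly m h t) <= m)%N.
Proof.
apply: leq_trans (size_sum _ _ _) _; apply/bigmax_leqP => k _.
by apply: leq_trans (size_scale_leq _ _) _; rewrite size_exp_XsubC.
Qed.

Lemma horner_taylor_poly_center m h t : (taylor_poly m.+1 h t).[t] = h 0 t.
Proof.
rewrite horner_sum big_ord_recl big1 => [|k _].
  by rewrite hornerZ expr0 hornerC fact0 divr1 mulr1 addr0.
by rewrite hornerZ horner_exp hornerXsubC subrr expr0n mulr0.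
Qed.

Lemma deriv_taylor_poly m h t :
  (taylor_poly m.+1 h t)^`() = taylor_poly m (h \o S) t.
Proof.
rewrite /taylor_poly raddf_sum big_ord_recl /= derivZ expr0 derivC scaler0.
rewrite add0r; apply: eq_bigr => k _.
rewrite /= derivZ deriv_exp derivXsubC mul1r.
rewrite -[_ ^+ _ *+ _]scaler_nat scalerA /bump /= add1n factS natrM.
by congr (_ *: _); rewrite invfM mulrA mulrAC divfK // pnatr_eq0.
Qed.

Lemma taylor_le m h M : deriv_chain m h ->
  (forall t, a <= t <= b -> `|h m t| <= M) ->
  forall t x, a <= t <= b -> a <= x <= b ->
  `|h 0 x - (taylor_poly m h t).[x]| <= M * `|x - t| ^+ m.
Proof.
elim: m h => [|m IHm] h h_chain h_le t x t_ab x_ab.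
  by rewrite /taylor_poly big_ord0 horner0 subr0 expr0 mulr1 h_le.
pose T := taylor_poly m.+1 h t.
have T_center : h 0 t - T.[t] = 0 by rewrite horner_taylor_poly_center subrr.
rewrite -[X in `|X|]subr0 -T_center exprSr mulrA.
have [h0_cont h0_derive] := h_chain 0 isT.
apply: (@mean_value_le (h 0 - horner T)
  (fun y => h 1 y - (taylor_poly m (h \o S) t).[y])) => // [|y y_ab|y y_ab yx].
- apply: within_continuousB => //.
  exact/continuous_subspaceT/continuous_horner.
- have ? := h0_derive y y_ab.
  by rewrite -deriv_taylor_poly; exact: is_deriveB.
- apply: le_trans (IHm _ (deriv_chain_shift h_chain) h_le t y t_ab y_ab) _.
  by rewrite ler_wpM2l ?lerXn2r ?nnegrE // (le_trans _ (h_le t t_ab)).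
Qed.

Lemma normr_lagrange_le m u t (c : R) (l : 'I_m) : injective u -> 1 <= c ->
  (forall j : 'I_m, j != l -> `|t - u j| <= c * `|u l - u j|) ->
  `|(tnth (lagrange m u) l : {poly R}).[t]| <= c ^+ m.
Proof.
move=> u_inj c_ge1 dist_le; rewrite lagrangeE //; last first.
  exact: leq_ltn_trans (leq0n l) (ltn_ord l).
rewrite /= hornerM hornerC !horner_prod -prodfV -big_split /= normr_prod.
apply: (@le_trans _ _ (\prod_(j < m | j != l) c)).
  apply: ler_prod => j jl; rewrite normr_ge0 /= !hornerXsubC.
  have u_neq : 0 < `|u l - u j|.
    by rewrite normr_gt0 subr_eq0 (inj_eq u_inj) eq_sym.
  by rewrite mulrC normrM normfV ler_pdivrMr ?dist_le.
rewrite prodr_const ler_weXn2l //.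
by apply: leq_trans (max_card _) _; rewrite card_ord.
Qed.

(* Lagrange interpolation reproduces the Taylor polynomial at [t], whose nodal
   values differ from those of [h 0] by the Taylor remainder. *)
Lemma interpolation_le m h M u t (c delta eps : R) :
  (0 < m)%N -> deriv_chain m h -> (forall x, a <= x <= b -> `|h m x| <= M) ->
  injective u -> a <= t <= b -> 1 <= c ->
  (forall l, (l < m)%N ->
    [/\ a <= u l <= b, `|t - u l| <= delta & `|h 0 (u l)| <= eps]) ->
  (forall i j, (i < m)%N -> (j < m)%N -> j != i ->
    `|t - u j| <= c * `|u i - u j|) ->
  `|h 0 t| <= m%:R * c ^+ m * (eps + M * delta ^+ m).
Proof.
move=> m_gt0 h_chain h_le u_inj t_ab c_ge1 u_near u_sep.
pose T := taylor_poly m h t.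
pose ell (l : 'I_m) : {poly R} := tnth (lagrange m u) l.
have T_le : (size T <= m)%N := size_taylor_poly m h t.
have h0E : h 0 t = \sum_(l < m) T.[u l] * (ell l).[t].
  transitivity T.[t].
    by rewrite /T -(prednK m_gt0) horner_taylor_poly_center.
  rewrite [in LHS](lagrange_gen m_gt0 u_inj T_le) horner_sum.
  by apply: eq_bigr => l _; rewrite hornerM hornerC.
rewrite h0E; apply: le_trans (ler_norm_sum _ _ _) _.
rewrite -mulrA mulr_natl -[X in _ *+ X]card_ord -sumr_const.
apply: ler_sum => l _; have [u_ab tu_le hu_le] := u_near l (ltn_ord l).
rewrite normrM mulrC; apply: ler_pM => //.
  by apply: normr_lagrange_le => // j; exact: (u_sep l j).
have -> : T.[u l] = h 0 (u l) - (h 0 (u l) - T.[u l]) by ring.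
apply: le_trans (ler_normB _ _) (lerD hu_le _).
apply: le_trans (taylor_le h_chain h_le t_ab u_ab) _.
rewrite distrC ler_wpM2l ?lerXn2r ?nnegrE ?(le_trans _ tu_le) //.
exact: le_trans (h_le t t_ab).
Qed.

End Segment.

Lemma equispaced_window (R : realType) (m p : nat) (t : R) :
  (0 < m)%N -> (m <= p)%N -> 0 <= t <= 1 ->
  exists2 k : nat, (k + m <= p)%N &
    forall l, (l <= m)%N -> `|t - (k + l)%:R / p%:R| <= m%:R / p%:R.
Proof.
move=> m_gt0 mp t01.
have pR_gt0 : 0 < p%:R :> R by rewrite ltr0n (leq_trans m_gt0).
have /andP[trunc_le trunc_gt] :=
  truncn_itv (mulr_ge0 (ltW pR_gt0) (proj1 (andP t01))).
pose k := minn (Num.truncn (p%:R * t)) (p - m).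
exists k => [|l lm]; first by rewrite /k; lia.
have k_le : k%:R <= p%:R * t.
  by apply: le_trans trunc_le; rewrite ler_nat geq_minl.
have k_ge : p%:R * t <= k%:R + m%:R.
  rewrite -natrD /k /minn; case: ifP => [k_lt|_].
    by apply: le_trans (ltW trunc_gt) _; rewrite ler_nat -addn1 leq_add2l.
  by rewrite subnK // -[leRHS]mulr1 ler_wpM2l //; case/andP: t01.
have -> : t - (k + l)%:R / p%:R = (p%:R * t - k%:R - l%:R) / p%:R.
  by rewrite natrD; field; rewrite gt_eqF.
rewrite normrM normfV (gtr0_norm pR_gt0) ler_wpM2r ?invr_ge0 ?ler0n //.
have lmR : l%:R <= m%:R :> R by rewrite ler_nat.
have l_ge0 : 0 <= l%:R :> R by [].
by rewrite ler_norml; lra.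
Qed.

Lemma equispaced_interpolation_le (R : realType) (m p : nat)
    (h : nat -> R -> R) (M eps t : R) :
  (0 < m)%N -> (m <= p)%N -> deriv_chain 0 1 m h ->
  (forall x, 0 <= x <= 1 -> `|h m x| <= M) ->
  (forall i, (i < p)%N -> `|h 0 (i%:R / p%:R)| <= eps) ->
  0 <= t <= 1 ->
  `|h 0 t| <= m%:R ^+ m.+1 * (eps + M * (m%:R / p%:R) ^+ m).
Proof.
move=> m_gt0 mp h_chain h_le h0_le t01.
have p_gt0 : 0 < p%:R :> R by rewrite ltr0n (leq_trans m_gt0).
have [k kmp t_near] := equispaced_window m_gt0 mp t01.
pose u l : R := (k + l)%:R / p%:R.
have uB i j : u i - u j = (i%:R - j%:R) / p%:R by rewrite /u !natrD; ring.
rewrite exprS; apply: (interpolation_le (u := u) m_gt0 h_chain h_le) => //.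
- move=> i j; rewrite /u => /(divIf (lt0r_neq0 p_gt0))/eqP.
  by rewrite eqr_nat eqn_add2l => /eqP.
- by rewrite ler1n.
- move=> l lm; split; last by apply: h0_le; lia.
    by rewrite divr_ge0 ?ler0n //= ler_pdivrMr // mul1r ler_nat; lia.
  exact/t_near/ltnW.
- move=> i j im jm ji; apply: le_trans (t_near j (ltnW jm)) _.
  rewrite ler_wpM2l ?ler0n // uB normrM normfV (gtr0_norm p_gt0).
  rewrite ler_peMl ?invr_ge0 ?ler0n //.
  rewrite -[i%:R]/(i%:Z%:~R) -[j%:R]/(j%:Z%:~R) -rmorphB -intr_norm ler1z.
  by lia.
Qed.

(** * Interpolation on the cube *)

Section Slices.
Variables (R : realType) (d : nat).
Implicit Types (x y : 'rV[R]_d) (t h L B : R) (f g : 'rV[R]_d -> R).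

Lemma setcoordE x k t (j : 'I_d) :
  setcoord x k t ord0 j = if (j : nat) == k then t else x ord0 j.
Proof. by rewrite mxE. Qed.

Lemma setcoordD x (j : 'I_d) t h :
  setcoord x j t + h *: delta_mx ord0 j = setcoord x j (h + t).
Proof.
apply/rowP => i; rewrite !mxE eqxx /= val_eqE.
by case: eqVneq => _; rewrite ?mulr1 ?mulr0 ?addr0 // addrC.
Qed.

Lemma setcoord_id x (j : 'I_d) : setcoord x j (x ord0 j) = x.
Proof. by apply/rowP => i; rewrite mxE val_eqE; case: eqVneq => // ->. Qed.

Lemma setcoordC x k l t h : k != l ->
  setcoord (setcoord x k t) l h = setcoord (setcoord x l h) k t.
Proof.
move=> kl; apply/rowP => i; rewrite !mxE.
by case: eqVneq => // ->; rewrite eq_sym (negbTE kl).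
Qed.

Lemma setcoord_idem x k t h : setcoord (setcoord x k t) k h = setcoord x k h.
Proof. by apply/rowP => i; rewrite !mxE; case: eqVneq. Qed.

Lemma cube_setcoord x k t : cube x -> 0 <= t <= 1 -> cube (setcoord x k t).
Proof. by move=> x_cube t01 j; rewrite setcoordE; case: eqP. Qed.

Lemma cube0 : cube (0 : 'rV[R]_d).
Proof. by move=> j; rewrite mxE lexx ler01. Qed.

Lemma setcoord_continuous x (j : 'I_d) : continuous (fun t => setcoord x j t).
Proof.
have setcoordE0 t : setcoord x j t = setcoord x j 0 + t *: delta_mx ord0 j.
  by rewrite setcoordD addr0.
rewrite (funext setcoordE0) => t.
by apply: cvgD; [exact: cvg_cst|exact: scalel_continuous].
Qed.

Lemma slice_continuous f x (j : 'I_d) : cube x ->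
  {within @cube R d, continuous f} ->
  {within `[0, 1], continuous (fun t => f (setcoord x j t))}.
Proof.
move=> x_cube /subspace_continuousP f_cont; apply/subspace_continuousP => t.
rewrite /= in_itv /= => t01.
apply: cvg_comp (f_cont _ (cube_setcoord j x_cube t01)) => P.
rewrite nbhs_simpl /= => /(@setcoord_continuous x j t); rewrite nbhs_simpl /=.
apply: filterS => u Pu; rewrite /= in_itv /= => u01.
by apply: Pu; exact: cube_setcoord.
Qed.

Lemma dfilter_interior x (j : 'I_d) t : cube x -> 0 < t < 1 ->
  dfilter j (setcoord x j t) = (0 : R)^'.
Proof.
move=> x_cube t01; apply/funext => P; apply/propext; split; last first.
  by apply: filterS => h Ph _.
have cube_near : \forall h \near (0 : R)^',
    cube (setcoord x j t + h *: delta_mx ord0 j).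
  have tDh : (fun h => h + t) @ (0 : R) --> t.
    rewrite -[X in _ --> X]add0r.
    by apply: cvgD; [exact: cvg_id|exact: cvg_cst].
  have h_near : \forall h \near (0 : R)^', h + t \in `]0, 1[.
    apply/cvg_within/(tDh (fun u => u \in `]0, 1[)).
    by apply: near_in_itvoo; rewrite in_itv.
  apply: filterS h_near => h; rewrite in_itv /= => h01.
  by rewrite setcoordD; apply: cube_setcoord => //; lra.
move=> P_near; near=> h.
have : cube (setcoord x j t + h *: delta_mx ord0 j) by near: h.
by near: h.
Unshelve. all: by end_near. Qed.

Lemma slice_derive f x (j : 'I_d) t : cube x -> 0 < t < 1 ->
  pderivable j f (setcoord x j t) ->
  is_derive t 1 (fun u => f (setcoord x j u)) (pderiv j f (setcoord x j t)).
Proof.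
move=> x_cube t01; rewrite /pderivable /pderiv dfilter_interior //.
have -> : dquot j f (setcoord x j t) = (fun h => h^-1 *:
    (f (setcoord x j (h *: 1 + t)) - f (setcoord x j t))).
  by apply/funext => h; rewrite /dquot setcoordD /GRing.scale /= mulr1.
by move=> f_cvg; apply: DeriveDef.
Qed.

Lemma Cm_slice_deriv_chain m f x (j : 'I_d) : Cm m f -> cube x ->
  deriv_chain 0 1 m (fun k t => pderivs (nseq k j) f (setcoord x j t)).
Proof.
move=> [f_derivable f_cont] x_cube k km; split=> [|t t01].
  by apply: slice_continuous => //; apply: f_cont; rewrite size_nseq ltnW.
apply: slice_derive => //; apply: f_derivable; first by rewrite size_nseq.
by apply: cube_setcoord => //; lra.
Qed.

Definition coord_lipschitz L f : Prop :=
  forall x (j : 'I_d) s t, cube x -> 0 <= s <= 1 -> 0 <= t <= 1 ->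
  `|f (setcoord x j s) - f (setcoord x j t)| <= L * `|s - t|.

Lemma Fclass_coord_lipschitz m B f : (0 < m)%N -> Fclass m B f ->
  coord_lipschitz B f.
Proof.
move=> m_gt0 [f_Cm f_le] x j s t x_cube s01 t01.
have [f_cont f_derive] := Cm_slice_deriv_chain j f_Cm x_cube m_gt0.
apply: mean_value_le f_cont f_derive _ => // y y01 _.
by apply: (f_le [:: j]) => //; exact: cube_setcoord.
Qed.

Definition grid_coord (p : nat) t : Prop :=
  exists2 i, (i < p)%N & t = i%:R / p%:R.

Fixpoint grid (p k : nat) x : seq 'rV[R]_d :=
  if k is k'.+1 then
    [seq y | i <- index_iota 0 p, y <- grid p k' (setcoord x k' (i%:R / p%:R))]
  else [:: x].

Lemma size_grid p k x : size (grid p k x) = (p ^ k)%N.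
Proof.
elim: k x => [|k IHk] x //=.
rewrite size_allpairs_dep; under eq_map do rewrite IHk.
rewrite sumnE big_map big_const_seq count_predT size_iota iter_addn_0 subn0.
by rewrite expnSr.
Qed.

Lemma grid_node_itv p i : (i < p)%N -> 0 <= (i%:R / p%:R : R) <= 1.
Proof.
move=> ip; have p_gt0 : 0 < p%:R :> R by rewrite ltr0n; lia.
by rewrite divr_ge0 ?ler0n //= ler_pdivrMr // mul1r ler_nat ltnW.
Qed.

Lemma grid_cube p k x : cube x -> {in grid p k x, forall y, cube y}.
Proof.
elim: k x => [|k IHk] x x_cube y /=; first by rewrite inE => /eqP ->.
case/allpairsPdep => i [z [ip z_grid ->]]; apply: IHk z_grid => //.
apply: cube_setcoord => //; apply: grid_node_itv.
by move: ip; rewrite mem_index_iota.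
Qed.

Lemma mem_grid p k x y :
  (forall j : 'I_d, (j < k)%N -> grid_coord p (y ord0 j)) ->
  (forall j : 'I_d, (k <= j)%N -> y ord0 j = x ord0 j) ->
  (k <= d)%N -> y \in grid p k x.
Proof.
elim: k x => [|k IHk] x y_node y_eq kd /=.
  by rewrite inE; apply/eqP/rowP => j; exact: y_eq.
have [i ip yi] := y_node (Ordinal kd) (leqnn _).
apply/allpairsPdep; exists i, y; split; rewrite ?mem_index_iota //.
apply: IHk => [j jk|j kj|]; [by apply: y_node; lia| |lia].
rewrite setcoordE; case: eqP => [jk|/eqP jk].
  by rewrite -yi; congr (y _ _); apply: val_inj.
by apply: y_eq; lia.
Qed.

(* Each coordinate that leaves the grid costs one univariate interpolation. *)
Definition interpolation_const m k : R :=
  iter k (fun c => m%:R ^+ m.+1 * (c + 1)) 0.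

Lemma interpolation_const_ge0 m k : 0 <= interpolation_const m k.
Proof.
by elim: k => //= k IHk; rewrite mulr_ge0 ?exprn_ge0 ?addr_ge0.
Qed.

Lemma eq_on_grid_le m p B f g : (0 < m)%N -> (m <= p)%N ->
  Fclass m B f -> Fclass m B g -> {in grid p d 0, f =1 g} ->
  forall x, cube x ->
  `|f x - g x| <= interpolation_const m d * (2 * B * (m%:R / p%:R) ^+ m).
Proof.
move=> m_gt0 mp [f_Cm f_le] [g_Cm g_le] fg.
suff free_coords k : (k <= d)%N -> forall x, cube x ->
    (forall j : 'I_d, (k <= j)%N -> grid_coord p (x ord0 j)) ->
    `|f x - g x| <= interpolation_const m k * (2 * B * (m%:R / p%:R) ^+ m).
  by move=> x x_cube; apply: free_coords => // j; rewrite leqNgt ltn_ord.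
elim: k => [|k IHk] kd x x_cube x_node.
  rewrite fg ?subrr ?normr0 /= ?mul0r //.
  apply: mem_grid => // j; first by move=> _; exact: x_node.
  by rewrite leqNgt ltn_ord.
pose j := Ordinal kd.
have slice_cube t : 0 <= t <= 1 -> cube (setcoord x j t).
  exact: cube_setcoord.
have fg_chain := deriv_chainB (Cm_slice_deriv_chain j f_Cm x_cube)
  (Cm_slice_deriv_chain j g_Cm x_cube).
rewrite -(setcoord_id x j) /= -/(interpolation_const m k).
rewrite [X in _ <= X](_ : _ = m%:R ^+ m.+1 * (interpolation_const m k *
  (2 * B * (m%:R / p%:R) ^+ m) + 2 * B * (m%:R / p%:R) ^+ m)); last by ring.
apply: (equispaced_interpolation_le m_gt0 mp fg_chain) => [t t01|i ip|].
- apply: le_trans (ler_normB _ _) _; rewrite mulr2n mulrDl mul1r.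
  apply: lerD; [apply: f_le|apply: g_le]; rewrite ?size_nseq //;
    exact: slice_cube.
- apply: IHk; [exact: ltnW|exact/slice_cube/grid_node_itv|move=> l kl].
  rewrite setcoordE; case: eqP => [_|/eqP lk]; first by exists i.
  by apply: x_node; move: lk => /=; lia.
- exact: x_cube.
Qed.

End Slices.

(** * Riemann sums for iterated integrals *)

Section IntervalIntegral.
Variable R : realType.
Implicit Types (F : R -> R) (a b L s t : R).
Local Notation lebesgue := (@lebesgue_measure R).

Lemma Rintegral_itv_partition F (u : nat -> R) n :
  {homo u : i j / (i <= j)%N >-> i <= j} ->
  lebesgue.-integrable `[u 0, u n] (EFin \o F) ->
  \int[lebesgue]_(t in `[u 0, u n]) F t =
  \sum_(i < n) \int[lebesgue]_(t in `]u i, u i.+1]) F t.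
Proof.
move=> u_homo; elim: n => [|n IHn] F_int.
  by rewrite big_ord0 set_itv1 Rintegral_set1.
rewrite big_ord_recr /= -IHn; last first.
  apply: integrableS F_int => //; apply: subset_itvl.
  by rewrite bnd_simp u_homo.
rewrite -(@Rintegral_itvB _ F (BLeft (u 0)) _ (u n)) ?bnd_simp ?u_homo //.
by rewrite addrC subrK.
Qed.

Lemma Rintegral_itv_bounds F a b (lo hi : R) : a < b ->
  lebesgue.-integrable `]a, b] (EFin \o F) ->
  (forall t, a < t <= b -> lo <= F t <= hi) ->
  (b - a) * lo <= \int[lebesgue]_(t in `]a, b]) F t <= (b - a) * hi.
Proof.
move=> ab F_int F_itv.
have itv_length : fine (lebesgue `]a, b]%classic) = b - a.
  by rewrite lebesgue_measure_itv /= lte_fin ab.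
have cst_integrable c : lebesgue.-integrable `]a, b] (EFin \o cst c).
  apply: measurable_bounded_integrable => //=; last exact: bounded_cst.
  by rewrite lebesgue_measure_itv /= lte_fin ab -EFinB ltry.
have integral_cst c : (b - a) * c = \int[lebesgue]_(t in `]a, b]) cst c t.
  by rewrite Rintegral_cst // itv_length mulrC.
by rewrite !integral_cst; apply/andP; split; apply: le_Rintegral => // t;
  rewrite /= in_itv /= => /F_itv/andP[].
Qed.

Definition log_lipschitz a b L F : Prop := forall s t,
  a <= s <= b -> a <= t <= b -> F s <= expR (L * `|s - t|) * F t.

Lemma log_lipschitz_ge a b L F s t : log_lipschitz a b L F ->
  a <= s <= b -> a <= t <= b -> expR (- (L * `|s - t|)) * F t <= F s.
Proof.
move=> F_lip s_ab t_ab.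
by rewrite expRN mulrC ler_pdivrMr ?expR_gt0 // mulrC distrC F_lip.
Qed.

Lemma log_lipschitz_continuous a b L F : log_lipschitz a b L F ->
  {within `[a, b], continuous F}.
Proof.
move=> F_lip; apply/subspace_continuousP => t; rewrite /= in_itv /= => t_ab.
have envelope_cvg (c : R) : expR (c * `|s - t|) * F t @[s --> t] --> F t.
  rewrite -[X in _ --> X]mul1r -expR0 -(mulr0 c) -[in X in c * X](normr0 R).
  rewrite -(subrr t); apply: cvgM; last exact: cvg_cst.
  apply: continuous_cvg; first exact: continuous_expR.
  apply: cvgM; first exact: cvg_cst.
  by apply: cvg_norm; apply: cvgB; [exact: cvg_id|exact: cvg_cst].
apply: (@squeeze_cvgr _ _ _ _ (fun s => expR (- L * `|s - t|) * F t)
   (fun s => expR (L * `|s - t|) * F t)).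
- apply: (@nearW R (nbhs t)) => s; rewrite /= in_itv /= => s_ab.
  by rewrite mulNr (log_lipschitz_ge F_lip) ?F_lip.
- exact: cvg_within_filter (envelope_cvg (- L)).
- exact: cvg_within_filter (envelope_cvg L).
Qed.

Lemma log_lipschitz_integrable a b L F : log_lipschitz a b L F ->
  lebesgue.-integrable `[a, b] (EFin \o F).
Proof.
move=> F_lip.
apply: continuous_compact_integrable; first exact: segment_compact.
exact: log_lipschitz_continuous F_lip.
Qed.

Lemma log_lipschitz_cell a b L F : 0 <= L -> a < b -> 0 <= F a ->
  log_lipschitz a b L F ->
  (b - a) * (expR (- (L * (b - a))) * F a) <=
    \int[lebesgue]_(t in `]a, b]) F t <=
  (b - a) * (expR (L * (b - a)) * F a).
Proof.
move=> L_ge0 ab Fa_ge0 F_lip; apply: Rintegral_itv_bounds => // [|t t_ab].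
  apply: integrableS (log_lipschitz_integrable F_lip) => //.
  exact: subset_itv_oc_cc.
have [at_ab tt_ab] : a <= a <= b /\ a <= t <= b by split; lra.
have dist_le : L * `|t - a| <= L * (b - a).
  by rewrite ler_wpM2l // ger0_norm; lra.
apply/andP; split.
  apply: le_trans (log_lipschitz_ge F_lip tt_ab at_ab).
  by rewrite ler_wpM2r // ler_expR lerN2.
apply: le_trans (F_lip t a tt_ab at_ab) _.
by rewrite ler_wpM2r // ler_expR.
Qed.

Lemma log_lipschitz_riemann L F p : 0 <= L -> (0 < p)%N ->
  (forall t, 0 <= t <= 1 -> 0 < F t) -> log_lipschitz 0 1 L F ->
  let riemann_sum := p%:R^-1 * \sum_(i < p) F (i%:R / p%:R) in
  expR (- (L / p%:R)) * riemann_sum <= \int[lebesgue]_(t in `[0, 1]) F t <=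
  expR (L / p%:R) * riemann_sum.
Proof.
move=> L_ge0 p_gt0 F_gt0 F_lip.
pose u i : R := i%:R / p%:R.
have pR_gt0 : 0 < p%:R :> R by rewrite ltr0n.
have u_homo : {homo u : i j / (i <= j)%N >-> i <= j}.
  by move=> i j ij; rewrite ler_pM2r ?invr_gt0 // ler_nat.
have [u0 u1] : u 0 = 0 /\ u p = 1 by rewrite /u mul0r divff ?gt_eqF.
have cell_length i : u i.+1 - u i = p%:R^-1.
  by rewrite -mulrBl -natr1 addrAC subrr add0r mul1r.
have cell (i : 'I_p) : p%:R^-1 * (expR (- (L / p%:R)) * F (u i)) <=
    \int[lebesgue]_(t in `]u i, u i.+1]) F t <=
    p%:R^-1 * (expR (L / p%:R) * F (u i)).
  have [ui_ge0 ui1_le1] : 0 <= u i /\ u i.+1 <= 1.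
    by rewrite -{1}u0 -u1 !u_homo.
  have ui_lt : u i < u i.+1 by rewrite -subr_gt0 cell_length invr_gt0.
  rewrite -(cell_length i); apply: log_lipschitz_cell => //.
    by apply/ltW/F_gt0; lra.
  by move=> s t s_cell t_cell; apply: F_lip; lra.
have -> : \int[lebesgue]_(t in `[0, 1]) F t =
    \sum_(i < p) \int[lebesgue]_(t in `]u i, u i.+1]) F t.
  rewrite -(Rintegral_itv_partition u_homo) u0 u1 //.
  exact: log_lipschitz_integrable F_lip.
rewrite /= !(mulrCA (expR _)) !mulr_sumr.
by apply/andP; split; apply: ler_sum => i _; have /andP[] := cell i.
Qed.

Lemma log_lipschitz_Rintegral d (T : measurableType d)
    (mu : {measure set T -> \bar R}) (D : set T) a b L (G : R -> T -> R) :
  measurable D -> (forall s, a <= s <= b -> mu.-integrable D (EFin \o G s)) ->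
  (forall y, D y -> log_lipschitz a b L (G^~ y)) ->
  log_lipschitz a b L (fun s => \int[mu]_(y in D) G s y).
Proof.
move=> D_meas G_int G_lip s t s_ab t_ab.
rewrite -RintegralZl //; last exact: G_int.
apply: le_Rintegral => // [||y Dy]; first exact: G_int; last exact: G_lip.
have := integrableZl D_meas (expR (L * `|s - t|)) (G_int t t_ab).
by apply: eq_integrable => // y _; rewrite /= EFinM.
Qed.

End IntervalIntegral.

Section CubeIntegral.
Variables (R : realType) (d : nat).
Implicit Types (x y : 'rV[R]_d) (f g : 'rV[R]_d -> R) (L t : R).

(* Unlike Lipschitz continuity of [ln \o g], this form is visibly preserved when
   a coordinate is integrated out. *)
Definition cube_log_lipschitz L g : Prop := (forall x, cube x -> 0 < g x) /\
  forall x (j : 'I_d), cube x ->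
    log_lipschitz 0 1 L (fun t => g (setcoord x j t)).

Lemma coord_lipschitz_expR L f : coord_lipschitz L f ->
  cube_log_lipschitz L (fun x => expR (f x)).
Proof.
move=> f_lip; split=> [x _|x j x_cube s t s01 t01]; first exact: expR_gt0.
rewrite -expRD ler_expR -lerBlDr; apply: le_trans (ler_norm _) _.
exact: f_lip.
Qed.

Lemma cube_log_lipschitz_integral L g k : 0 <= L -> cube_log_lipschitz L g ->
  (k <= d)%N -> cube_log_lipschitz L (cube_int_aux k g).
Proof.
move=> L_ge0 g_lip; elim: k => [|k IHk] kd //=.
have [G_gt0 G_lip] := IHk (ltnW kd); set G := cube_int_aux k g in G_gt0 G_lip *.
have line_lip x : cube x -> log_lipschitz 0 1 L (fun t => G (setcoord x k t)).
  exact: (G_lip x (Ordinal kd)).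
have line_gt0 x t : cube x -> 0 <= t <= 1 -> 0 < G (setcoord x k t).
  by move=> x_cube t01; apply: G_gt0; exact: cube_setcoord.
split=> [x x_cube|x j x_cube].
  have /andP[riemann_le _] := log_lipschitz_riemann L_ge0 (ltn0Sn 0)
    (fun t => line_gt0 x t x_cube) (line_lip x x_cube).
  apply: lt_le_trans riemann_le; rewrite mulr_gt0 ?expR_gt0 // invr1 mul1r.
  by rewrite big_ord1 mul0r line_gt0 // lexx ler01.
have [jk|jk] := eqVneq (j : nat) k.
  have line_eq s : (fun t => G (setcoord (setcoord x k s) k t)) =
      (fun t => G (setcoord x k t)).
    by apply/funext => t; rewrite setcoord_idem.
  move=> s t s01 t01; rewrite jk !line_eq ler_peMl //.
    by apply: Rintegral_ge0 => r r01; rewrite ltW // line_gt0.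
  by rewrite -expR0 ler_expR mulr_ge0.
apply: log_lipschitz_Rintegral => // [s s01|t].
  by apply: log_lipschitz_integrable (line_lip _ _); exact: cube_setcoord.
rewrite /= in_itv /= => t01 s s' s01 s'01; rewrite !(setcoordC _ _ _ jk).
by apply: G_lip => //; exact: cube_setcoord.
Qed.

Definition grid_mean p k g x : R :=
  (p ^ k)%:R^-1 * \sum_(y <- grid p k x) g y.

Lemma grid_meanS p k g x : grid_mean p k.+1 g x =
  p%:R^-1 * \sum_(i < p) grid_mean p k g (setcoord x k (i%:R / p%:R)).
Proof.
rewrite /grid_mean /= big_allpairs_dep /= big_mkord -mulr_sumr mulrA.
by rewrite expnS natrM invfM.
Qed.

Lemma grid_mean_gt0 p k g x : (0 < p)%N -> cube x ->
  (forall y, cube y -> 0 < g y) -> 0 < grid_mean p k g x.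
Proof.
move=> p_gt0 x_cube g_gt0.
rewrite mulr_gt0 ?invr_gt0 ?ltr0n ?expn_gt0 ?p_gt0 //.
have : (0 < size (grid p k x))%N by rewrite size_grid expn_gt0 p_gt0.
have := grid_cube (p := p) (k := k) x_cube.
case: (grid p k x) => // y s ys_cube _; rewrite big_cons ltr_pwDl //.
  exact/g_gt0/ys_cube/mem_head.
rewrite big_seq sumr_ge0 // => z zs.
by apply/ltW/g_gt0/ys_cube; rewrite inE zs orbT.
Qed.

Lemma cube_int_aux_riemann L g p k x : 0 <= L -> cube_log_lipschitz L g ->
  (0 < p)%N -> (k <= d)%N -> cube x ->
  expR (- (k%:R * (L / p%:R))) * grid_mean p k g x <= cube_int_aux k g x <=
  expR (k%:R * (L / p%:R)) * grid_mean p k g x.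
Proof.
move=> L_ge0 g_lip p_gt0; elim: k x => [|k IHk] x kd x_cube.
  rewrite /grid_mean /= big_seq1 expn0 invr1 mul1r mul0r oppr0 expR0 mul1r.
  by rewrite lexx.
have [G_gt0 G_lip] := cube_log_lipschitz_integral L_ge0 g_lip (ltnW kd).
have /= /andP[sum_le le_sum] := log_lipschitz_riemann L_ge0 p_gt0
  (fun t t01 => G_gt0 _ (cube_setcoord k x_cube t01))
  (G_lip x (Ordinal kd) x_cube).
have node_cube (i : 'I_p) : cube (setcoord x k (i%:R / p%:R)).
  exact/cube_setcoord/grid_node_itv.
have p_ge0 : 0 <= p%:R^-1 :> R by rewrite invr_ge0.
rewrite grid_meanS -natr1 mulrDl mul1r addrC opprD !expRD -!mulrA.
apply/andP; split.
- apply: le_trans sum_le; rewrite ler_wpM2l ?expR_ge0 // mulrCA ler_wpM2l //.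
  rewrite mulr_sumr; apply: ler_sum => i _.
  by have /andP[] := IHk _ (ltnW kd) (node_cube i).
- apply: le_trans le_sum _; rewrite ler_wpM2l ?expR_ge0 // mulrCA ler_wpM2l //.
  rewrite mulr_sumr; apply: ler_sum => i _.
  by have /andP[] := IHk _ (ltnW kd) (node_cube i).
Qed.

Lemma logpart_riemann L f p : 0 <= L -> coord_lipschitz L f -> (0 < p)%N ->
  `|logpart f - ln (grid_mean p d (fun y => expR (f y)) 0)| <=
    d%:R * (L / p%:R).
Proof.
move=> L_ge0 f_lip p_gt0; set S := grid_mean _ _ _ _.
have S_gt0 : 0 < S.
  by apply: grid_mean_gt0 => // [|y _]; [exact: cube0|exact: expR_gt0].
have eS_gt0 r : 0 < expR r * S by rewrite mulr_gt0 ?expR_gt0.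
have ln_eS r : ln (expR r * S) = r + ln S.
  by rewrite lnM ?posrE ?expR_gt0 // expRK.
have /andP[sum_le le_sum] := cube_int_aux_riemann L_ge0
  (coord_lipschitz_expR f_lip) p_gt0 (leqnn d) (@cube0 R d).
have int_gt0 := lt_le_trans (eS_gt0 _) sum_le.
have logpart_ge : - (d%:R * (L / p%:R)) + ln S <= logpart f.
  by rewrite -ln_eS ler_ln ?posrE.
have logpart_le : logpart f <= d%:R * (L / p%:R) + ln S.
  by rewrite -ln_eS ler_ln ?posrE.
by rewrite ler_norml; lra.
Qed.

End CubeIntegral.

(** * Finite means and independent samples *)

Section FiniteMean.
Variable R : realType.
Implicit Types (I T : finType) (c a b s : R).

Definition mean T (F : T -> R) : R := #|T|%:R^-1 * \sum_x F x.

Lemma eq_mean T (F G : T -> R) : F =1 G -> mean F = mean G.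
Proof. by move=> FG; congr (_ * _); exact: eq_bigr. Qed.

Lemma mean_cst T c : (0 < #|T|)%N -> mean (fun _ : T => c) = c.
Proof.
move=> T_gt0; rewrite /mean sumr_const -[c *+ _]mulr_natl mulrA mulVf ?mul1r //.
by rewrite pnatr_eq0 -lt0n.
Qed.

Lemma meanD T (F G : T -> R) : mean (fun x => F x + G x) = mean F + mean G.
Proof. by rewrite /mean big_split mulrDr. Qed.

Lemma meanZ T c (F : T -> R) : mean (fun x => c * F x) = c * mean F.
Proof. by rewrite /mean -mulr_sumr mulrCA. Qed.

Lemma le_mean T (F G : T -> R) : (forall x, F x <= G x) -> mean F <= mean G.
Proof. by move=> FG; rewrite ler_wpM2l ?invr_ge0 //; exact: ler_sum. Qed.

Lemma mean_itv T (F : T -> R) a b : (0 < #|T|)%N ->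
  (forall x, a <= F x <= b) -> a <= mean F <= b.
Proof.
move=> T_gt0 F_itv; rewrite -[a](mean_cst a T_gt0) -[b](mean_cst b T_gt0).
by apply/andP; split; apply: le_mean => x; case/andP: (F_itv x).
Qed.

Lemma exchange_mean I T (F : I -> T -> R) :
  mean (fun i => mean (F i)) = mean (fun x => mean (F^~ x)).
Proof.
rewrite /mean -!mulr_sumr mulrCA; congr (_ * (_ * _)); exact: exchange_big.
Qed.

Lemma meanM I T (F : I -> R) (G : T -> R) :
  mean F * mean G = mean (fun i => mean (fun x => F i * G x)).
Proof.
by rewrite mulrC -meanZ; apply: eq_mean => i; rewrite mulrC -meanZ.
Qed.

Lemma sqr_mean_le T (F : T -> R) : (0 < #|T|)%N ->
  mean F ^+ 2 <= mean (fun x => F x ^+ 2).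
Proof.
move=> T_gt0; rewrite -subr_ge0.
have -> : mean (fun x => F x ^+ 2) - mean F ^+ 2 =
    mean (fun x => (F x - mean F) ^+ 2).
  transitivity
    (mean (fun x => F x ^+ 2 + (- (2 * mean F) * F x + mean F ^+ 2))).
    by rewrite !meanD meanZ mean_cst //; ring.
  by apply: eq_mean => x; ring.
by rewrite mulr_ge0 ?invr_ge0 // sumr_ge0 // => x _; exact: sqr_ge0.
Qed.

Lemma mean_prod_ffun I T (F : I -> T -> R) :
  mean (fun w : {ffun I -> T} => \prod_i F i (w i)) = \prod_i mean (F i).
Proof.
by rewrite /mean big_split prodr_const bigA_distr_bigA card_ffun natrX exprVn.
Qed.

Lemma mean_ffun_uncorrelated I T (Y : T -> R) (i j : I) :
  (0 < #|T|)%N -> mean Y = 0 ->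
  mean (fun w : {ffun I -> T} => Y (w i) * Y (w j)) =
    (i == j)%:R * mean (fun x => Y x ^+ 2).
Proof.
move=> T_gt0 Y_mean0.
pose F l x := (if l == i then Y x else 1) * (if l == j then Y x else 1).
rewrite (eq_mean (G := fun w : {ffun I -> T} =>
  \prod_l F l (w l))) => [|w]; last first.
  by rewrite /F big_split /= -!big_mkcond !big_pred1_eq.
rewrite mean_prod_ffun (bigD1 i) //= /F eqxx.
have [->|ij] := eqVneq i j; last first.
  by under eq_mean do rewrite mulr1; rewrite Y_mean0 !mul0r.
rewrite big1 ?mulr1 ?mul1r // => l /negbTE ->.
by rewrite -[RHS](mean_cst 1 T_gt0); apply: eq_mean => x; rewrite mulr1.
Qed.

Lemma mean_sqr_sample_mean I T (Y : T -> R) : (0 < #|I|)%N -> (0 < #|T|)%N ->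
  mean Y = 0 ->
  mean (fun w : {ffun I -> T} => mean (fun i => Y (w i)) ^+ 2) =
    mean (fun x => Y x ^+ 2) / #|I|%:R.
Proof.
move=> I_gt0 T_gt0 Y_mean0.
under eq_mean do rewrite expr2 meanM.
rewrite exchange_mean.
under eq_mean => i do rewrite exchange_mean.
under eq_mean => i do under eq_mean => j do rewrite mean_ffun_uncorrelated //.
set v := mean (fun x => Y x ^+ 2).
rewrite -[RHS](mean_cst _ I_gt0); apply: eq_mean => i.
rewrite /mean (bigD1 i) //= eqxx mul1r big1 ?addr0 1?mulrC // => j.
by rewrite eq_sym => /negbTE ->; rewrite mul0r.
Qed.

Lemma mean_normr_sample_dev_le I T (F : T -> R) s :
  (0 < #|I|)%N -> (0 < #|T|)%N -> 0 <= s -> (forall x, `|F x - mean F| <= s) ->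
  mean (fun w : {ffun I -> T} => `|mean F - mean (fun i => F (w i))|) <=
    s / Num.sqrt #|I|%:R.
Proof.
move=> I_gt0 T_gt0 s_ge0 F_dev; pose Y x := F x - mean F.
have Y_mean0 : mean Y = 0 by rewrite meanD mean_cst // subrr.
have W_gt0 : (0 < #|{ffun I -> T}|)%N by rewrite card_ffun expn_gt0 T_gt0.
have IR_ge0 : 0 <= #|I|%:R :> R by [].
rewrite -ler_sqr ?nnegrE ?divr_ge0 ?sqrtr_ge0 //; last first.
  by rewrite mulr_ge0 ?invr_ge0 // sumr_ge0.
rewrite expr_div_n sqr_sqrtr //; apply: le_trans (sqr_mean_le _ W_gt0) _.
rewrite (eq_mean (G := fun w : {ffun I -> T} =>
  mean (fun i => Y (w i)) ^+ 2)) => [|w]; last first.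
  by rewrite real_normK ?num_real // meanD mean_cst // -sqrrN opprB.
rewrite mean_sqr_sample_mean // ler_wpM2r ?invr_ge0 //.
rewrite -[s ^+ 2](mean_cst _ T_gt0); apply: le_mean => x.
rewrite -real_normK ?num_real // lerXn2r ?nnegrE //; exact: F_dev.
Qed.

End FiniteMean.

Section RoundedWeights.
Variables (R : realType) (T : eqType) (s : seq T) (w : T -> R) (K : nat).
Variable y0 : T.
Hypotheses (K_gt0 : (0 < K)%N) (y0_s : y0 \in s).
Hypotheses (w_ge0 : forall y, 0 <= w y) (w_sum1 : \sum_(y <- s) w y = 1).

Let KR_gt0 : 0 < K%:R :> R. Proof. by rewrite ltr0n. Qed.

Definition multiplicity (y : T) : nat := Num.truncn (K%:R * w y).

Definition rounding_error (y : T) : R := K%:R * w y - (multiplicity y)%:R.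

(* The last block makes up for the atoms lost by rounding down. *)
Definition rounded_atoms : seq T :=
  flatten [seq nseq (multiplicity y) y | y <- s] ++
  nseq (K - \sum_(y <- s) multiplicity y) y0.

Lemma rounding_error_itv y : 0 <= rounding_error y <= 1.
Proof.
have /andP[trunc_le trunc_gt] := truncn_itv (mulr_ge0 (ltW KR_gt0) (w_ge0 y)).
by rewrite subr_ge0 trunc_le lerBlDr nat1r ltW.
Qed.

Lemma sum_rounding_error :
  \sum_(y <- s) rounding_error y = K%:R - (\sum_(y <- s) multiplicity y)%N%:R.
Proof. by rewrite sumrB -mulr_sumr w_sum1 mulr1 natr_sum. Qed.

Lemma sum_rounding_error_itv :
  0 <= \sum_(y <- s) rounding_error y <= (size s)%:R.
Proof.
rewrite sumr_ge0 /= => [|y _]; last by case/andP: (rounding_error_itv y).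
rewrite -[size s]count_predT -sum1_count natr_sum; apply: ler_sum => y _.
by case/andP: (rounding_error_itv y).
Qed.

Lemma sum_multiplicity_le : (\sum_(y <- s) multiplicity y <= K)%N.
Proof.
rewrite -(ler_nat R) -subr_ge0 -sum_rounding_error.
by case/andP: sum_rounding_error_itv.
Qed.

Lemma size_rounded_atoms : size rounded_atoms == K.
Proof.
rewrite size_cat size_flatten size_nseq /shape -map_comp sumnE big_map.
by under eq_bigr do rewrite /= size_nseq; rewrite subnKC ?sum_multiplicity_le.
Qed.

Lemma rounded_atoms_sub : {subset rounded_atoms <= s}.
Proof.
move=> y; rewrite mem_cat => /orP[/flatten_mapP[z zs]|].
  by rewrite mem_nseq => /andP[_ /eqP ->].
by rewrite mem_nseq => /andP[_ /eqP ->].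
Qed.

Lemma sum_rounded_atoms (F : T -> R) :
  \sum_(y <- rounded_atoms) F y - K%:R * \sum_(y <- s) w y * F y =
  \sum_(y <- s) rounding_error y * (F y0 - F y).
Proof.
have sum_nseq n y : \sum_(z <- nseq n y) F z = n%:R * F y.
  by rewrite big_nseq iter_addr_0 mulr_natl.
rewrite big_cat big_flatten big_map sum_nseq natrB ?sum_multiplicity_le //.
rewrite -sum_rounding_error; under eq_bigr do rewrite sum_nseq.
rewrite /= mulr_suml mulr_sumr -big_split -sumrB /=; apply: eq_bigr => y _.
by rewrite /rounding_error; ring.
Qed.

Lemma mean_rounded_atoms_error_le (F : T -> R) (C : R) :
  (forall y, y \in s -> `|F y| <= C) ->
  `|mean (fun k => F (tnth (Tuple size_rounded_atoms) k))
    - \sum_(y <- s) w y * F y| <= 2 * (size s)%:R / K%:R * C.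
Proof.
move=> F_le; have C_ge0 : 0 <= C := le_trans (normr_ge0 _) (F_le y0 y0_s).
have -> : mean (fun k => F (tnth (Tuple size_rounded_atoms) k))
    - \sum_(y <- s) w y * F y =
    (\sum_(y <- s) rounding_error y * (F y0 - F y)) / K%:R.
  rewrite -sum_rounded_atoms mulrBl mulrAC divff ?gt_eqF // mul1r.
  by rewrite /mean card_ord mulrC -(big_tuple _ _ _ xpredT F).
rewrite normrM normfV (gtr0_norm KR_gt0) [leRHS]mulrAC.
rewrite ler_wpM2r ?invr_ge0 //; apply: le_trans (ler_norm_sum _ _ _) _.
have /andP[_ error_le] := sum_rounding_error_itv.
apply: (@le_trans _ _ ((\sum_(y <- s) rounding_error y) * (2 * C))).
  rewrite mulr_suml big_seq [leRHS]big_seq; apply: ler_sum => y ys.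
  have /andP[error_ge0 _] := rounding_error_itv y.
  rewrite normrM ger0_norm // ler_wpM2l // mulr2n mulrDl mul1r.
  by apply: le_trans (ler_normB _ _) _; rewrite lerD ?F_le.
by rewrite [leRHS]mulrAC [leRHS]mulrC ler_wpM2r ?mulr_ge0.
Qed.

End RoundedWeights.

Lemma exists_atoms_of_weights (R : realType) (T : eqType) (s : seq T)
    (w : T -> R) (K : nat) :
  (0 < K)%N -> (forall y, 0 <= w y) -> \sum_(y <- s) w y = 1 ->
  exists a : K.-tuple T, {subset a <= s} /\
    forall (F : T -> R) C, (forall y, y \in s -> `|F y| <= C) ->
    `|mean (fun k => F (tnth a k)) - \sum_(y <- s) w y * F y| <=
      2 * (size s)%:R / K%:R * C.
Proof.
move=> K_gt0 w_ge0 w_sum1.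
have [y0 y0_s] : exists y0, y0 \in s.
  case: s w_sum1 => [|y0 s' _]; last by exists y0; rewrite mem_head.
  by rewrite big_nil => /eqP; rewrite eq_sym oner_eq0.
exists (Tuple (size_rounded_atoms y0 K_gt0 w_ge0 w_sum1)).
split=> [|F C]; first exact: rounded_atoms_sub.
exact: mean_rounded_atoms_error_le.
Qed.

(** * Importance sampling of the log-partition function *)

Section LogBounds.
Variable R : realType.
Implicit Types (c u v delta eps : R).

Lemma ln_lipschitz c u v : 0 < c -> c <= u -> c <= v ->
  `|ln u - ln v| <= `|u - v| / c.
Proof.
move=> c_gt0; wlog uv : u v / u <= v => [wlog_uv cu cv|cu cv].
  have [uv|/ltW vu] := leP u v; first exact: wlog_uv.
  by rewrite distrC [`|u - v|]distrC; exact: wlog_uv.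
have u_gt0 : 0 < u := lt_le_trans c_gt0 cu.
have v_gt0 : 0 < v := lt_le_trans u_gt0 uv.
have vBu_ge0 : 0 <= v - u by rewrite subr_ge0.
rewrite distrC [`|u - v|]distrC !ger0_norm ?subr_ge0 ?ler_ln ?posrE //.
rewrite -ln_div ?posrE //.
have -> : v / u = 1 + (v - u) / u by field; rewrite gt_eqF.
have ratio_ge0 : 0 <= (v - u) / u by rewrite divr_ge0 // ltW.
apply: le_trans (le_ln1Dx _) _; first by lra.
by rewrite ler_wpM2l // lef_pV2 ?posrE.
Qed.

Lemma ln_lipschitz_expR delta u v :
  expR (- delta) <= u -> expR (- delta) <= v ->
  `|ln u - ln v| <= expR delta * `|u - v|.
Proof.
move=> u_ge v_ge; apply: le_trans (ln_lipschitz (expR_gt0 _) u_ge v_ge) _.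
by rewrite expRN invrK mulrC.
Qed.

Lemma normr_ln_le delta u :
  expR (- delta) <= u <= expR delta -> `|ln u| <= delta.
Proof.
move=> /andP[u_ge u_le]; have u_gt0 := lt_le_trans (expR_gt0 _) u_ge.
by rewrite ler_norml -{1}[- delta]expRK -[X in _ && (_ <= X)]expRK
  !ler_ln ?posrE ?expR_gt0 // u_ge.
Qed.

Lemma expR_sub_expRN_le delta :
  expR delta - expR (- delta) <= 2 * delta * expR delta.
Proof.
have -> : expR (- delta) = expR (- (2 * delta)) * expR delta.
  by rewrite -expRD; congr expR; ring.
have := expR_ge1Dx (- (2 * delta)); have := expR_gt0 delta.
by move: (expR delta) (expR (- _)) => a b a_gt0 b_ge; nra.
Qed.

Lemma exists_div_le c eps : 0 < eps -> exists2 n, (0 < n)%N & c / n%:R <= eps.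
Proof.
move=> eps_gt0; exists (Num.truncn `|c / eps|).+1 => //.
have /andP[_ lt_trunc] := truncn_itv (normr_ge0 (c / eps)).
rewrite ler_pdivrMr ?ltr0n // mulrC -ler_pdivrMr //.
exact: le_trans (ler_norm _) (ltW lt_trunc).
Qed.

Lemma mean_ln_sample_dev_le (I T : finType) (X : T -> R) delta :
  (0 < #|I|)%N -> (0 < #|T|)%N -> 0 <= delta ->
  (forall x, expR (- delta) <= X x <= expR delta) ->
  mean (fun w : {ffun I -> T} =>
      `|ln (mean X) - ln (mean (fun i => X (w i)))|) <=
    expR (2 * delta) * (2 * delta) / Num.sqrt #|I|%:R.
Proof.
move=> I_gt0 T_gt0 delta_ge0 X_itv.
have meanX_itv := mean_itv T_gt0 X_itv.
have X_dev x : `|X x - mean X| <= 2 * delta * expR delta.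
  apply: le_trans (expR_sub_expRN_le delta).
  by have := X_itv x; rewrite ler_norml; lra.
apply: (@le_trans _ _ (mean (fun w : {ffun I -> T} =>
  expR delta * `|mean X - mean (fun i => X (w i))|))).
  apply: le_mean => w; apply: ln_lipschitz_expR; first by case/andP: meanX_itv.
  by have /andP[] := mean_itv I_gt0 (fun i => X_itv (w i)).
rewrite meanZ.
have -> : expR (2 * delta) * (2 * delta) / Num.sqrt #|I|%:R =
    expR delta * (2 * delta * expR delta / Num.sqrt #|I|%:R).
  by rewrite mulr2n mulrDl mul1r expRD; ring.
rewrite ler_wpM2l ?expR_ge0 // mean_normr_sample_dev_le //.
by rewrite !mulr_ge0 ?expR_ge0.
Qed.

End LogBounds.

Section ImportanceSampling.
Variables (R : realType) (d : nat).
Implicit Types (s : seq 'rV[R]_d) (f g : 'rV[R]_d -> R) (L delta eps : R).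

Definition gibbs_weight s g y : R := expR (g y) / \sum_(z <- s) expR (g z).

Lemma gibbs_weight_ge0 s g y : 0 <= gibbs_weight s g y.
Proof.
by rewrite divr_ge0 ?expR_ge0 // sumr_ge0 // => z _; exact: expR_ge0.
Qed.

Definition gibbs_mean_expRB s f g : R :=
  \sum_(y <- s) gibbs_weight s g y * expR (f y - g y).

Lemma gibbs_mean_expRBE s f g : gibbs_mean_expRB s f g =
  (\sum_(y <- s) expR (f y)) / \sum_(y <- s) expR (g y).
Proof.
rewrite mulr_suml; apply: eq_bigr => y _.
by rewrite /gibbs_weight mulrAC -expRD addrC subrK.
Qed.

Lemma sum_gibbs_weight s g : (0 < size s)%N ->
  \sum_(y <- s) gibbs_weight s g y = 1.
Proof.
move=> s_gt0; rewrite -mulr_suml divff // gt_eqF //.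
case: s s_gt0 => // y s _; rewrite big_cons ltr_pwDl ?expR_gt0 //.
by rewrite sumr_ge0 // => z _; exact: expR_ge0.
Qed.

Lemma gibbs_mean_expRB_itv s f g delta : (0 < size s)%N ->
  {in s, forall y, `|f y - g y| <= delta} ->
  expR (- delta) <= gibbs_mean_expRB s f g <= expR delta.
Proof.
move=> s_gt0 fg; rewrite -[X in X <= _]mul1r -[X in _ && (_ <= X)]mul1r.
rewrite -(sum_gibbs_weight g s_gt0) !mulr_suml /gibbs_mean_expRB.
apply/andP; split; rewrite big_seq [leRHS]big_seq; apply: ler_sum => y ys;
  rewrite ler_wpM2l ?gibbs_weight_ge0 // ler_expR;
  by have := fg y ys; rewrite ler_norml => /andP[].
Qed.

Lemma logpart_sub_riemann L f g p : 0 <= L -> coord_lipschitz L f ->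
  coord_lipschitz L g -> (0 < p)%N ->
  `|logpart f - logpart g - ln (gibbs_mean_expRB (grid p d 0) f g)| <=
  2 * (d%:R * L) / p%:R.
Proof.
move=> L_ge0 f_lip g_lip p_gt0.
have mean_gt0 h : 0 < grid_mean p d (fun y => expR (h y)) 0.
  by apply: grid_mean_gt0 => // [|y _]; [exact: cube0|exact: expR_gt0].
have -> : gibbs_mean_expRB (grid p d 0) f g =
    grid_mean p d (fun y => expR (f y)) 0 /
    grid_mean p d (fun y => expR (g y)) 0.
  rewrite gibbs_mean_expRBE /grid_mean invfM mulrACA divff ?mul1r //.
  by rewrite invr_eq0 pnatr_eq0 -lt0n expn_gt0 p_gt0.
rewrite ln_div ?posrE ?mean_gt0 //.
have -> (a b a' b' : R) : a - b - (a' - b') = a - a' - (b - b') by ring.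
apply: le_trans (ler_normB _ _) _.
have -> : 2 * (d%:R * L) / p%:R = d%:R * (L / p%:R) + d%:R * (L / p%:R) by ring.
by apply: lerD; exact: logpart_riemann.
Qed.

Definition density_ratio K (a : K.-tuple 'rV[R]_d) f g (k : 'I_K) : R :=
  expR (f (tnth a k) - g (tnth a k)).

Lemma density_ratio_itv K (a : K.-tuple 'rV[R]_d) f g delta k :
  {in a, forall y, `|f y - g y| <= delta} ->
  expR (- delta) <= density_ratio a f g k <= expR delta.
Proof. by move=> fg; rewrite !ler_expR -ler_norml fg ?mem_tnth. Qed.

Lemma exists_importance_atoms L delta eps : 0 <= L -> 0 < eps ->
  exists K (x : ('rV[R]_d -> R) -> K.-tuple 'rV[R]_d),
  [/\ (0 < K)%N, forall g, {in x g, forall y, cube y} &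
   forall f g, coord_lipschitz L f -> coord_lipschitz L g ->
   (forall y, cube y -> `|f y - g y| <= delta) ->
   `|logpart f - logpart g - ln (mean (density_ratio (x g) f g))| <= eps].
Proof.
move=> L_ge0 eps_gt0; have eps2_gt0 : 0 < eps / 2 by rewrite divr_gt0.
have [p p_gt0 p_fine] := exists_div_le (2 * (d%:R * L)) eps2_gt0.
pose s := grid p d (0 : 'rV[R]_d).
have s_cube : {in s, forall y, cube y} by apply: grid_cube; exact: cube0.
have s_gt0 : (0 < size s)%N by rewrite size_grid expn_gt0 p_gt0.
have [K K_gt0 K_large] :=
  exists_div_le (2 * (size s)%:R * (expR delta * expR delta)) eps2_gt0.
have /boolp.choice[x x_atoms] := fun g =>
  exists_atoms_of_weights K_gt0 (gibbs_weight_ge0 s g)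
    (sum_gibbs_weight g s_gt0).
exists K, x; split=> // [g y yx|f g f_lip g_lip fg].
  by have [x_s _] := x_atoms g; exact/s_cube/x_s.
have [x_s x_mean] := x_atoms g.
have fg_s : {in s, forall y, `|f y - g y| <= delta} by move=> y /s_cube/fg.
pose E := gibbs_mean_expRB s f g.
pose Z := mean (density_ratio (x g) f g).
have /andP[E_ge _] : expR (- delta) <= E <= expR delta.
  exact: gibbs_mean_expRB_itv.
have /andP[Z_ge _] : expR (- delta) <= Z <= expR delta.
  apply: mean_itv => [|k]; first by rewrite card_ord.
  by apply: density_ratio_itv => y /x_s/fg_s.
have EZ_le : `|E - Z| <= 2 * (size s)%:R / K%:R * expR delta.
  rewrite distrC; apply: x_mean => y ys.
  rewrite ger0_norm ?expR_ge0 // ler_expR.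
  exact: le_trans (ler_norm _) (fg_s y ys).
have lnEZ_le : `|ln E - ln Z| <= eps / 2.
  apply: le_trans (ln_lipschitz_expR E_ge Z_ge) _; apply: le_trans K_large.
  by apply: le_trans (ler_wpM2l (expR_ge0 _) EZ_le) _; lra.
have := le_trans (logpart_sub_riemann L_ge0 f_lip g_lip p_gt0) p_fine.
rewrite -/s -/E -/Z; move: lnEZ_le; rewrite !ler_norml; lra.
Qed.

Lemma logpart_lipschitz L delta f g : 0 <= L -> coord_lipschitz L f ->
  coord_lipschitz L g -> (forall y, cube y -> `|f y - g y| <= delta) ->
  `|logpart f - logpart g| <= delta.
Proof.
move=> L_ge0 f_lip g_lip fg; apply/ler_addgt0Pr => eps eps_gt0.
have [p p_gt0 p_fine] := exists_div_le (2 * (d%:R * L)) eps_gt0.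
have s_gt0 : (0 < size (grid p d (0 : 'rV[R]_d)))%N.
  by rewrite size_grid expn_gt0 p_gt0.
have fg_grid : {in grid p d 0, forall y, `|f y - g y| <= delta}.
  by move=> y /(grid_cube (@cube0 R d))/fg.
have ln_le := normr_ln_le (gibbs_mean_expRB_itv s_gt0 fg_grid).
have := le_trans (logpart_sub_riemann L_ge0 f_lip g_lip p_gt0) p_fine.
move: ln_le; set l := ln _; rewrite !ler_norml => l_le dist_le; lra.
Qed.

End ImportanceSampling.

(** * Two-stage algorithms *)

Section TwoStage.
Variables (R : realType) (d : nat).
Variables (X : seq 'rV[R]_d) (Q : seq R -> seq 'rV[R]_d).
Variable (phi : seq R -> seq R -> R).
Implicit Types f : 'rV[R]_d -> R.

Definition two_stage : adaptive_alg R d :=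
  {| node := fun v => if (size v < size X)%N then nth 0 X (size v)
                      else nth 0 (Q (take (size X) v)) (size v - size X);
     out := fun v => phi (take (size X) v) (drop (size X) v) |}.

Lemma two_stage_admissible : {in X, forall x, cube x} ->
  (forall v, {in Q v, forall x, cube x}) -> admissible two_stage.
Proof.
have nth_cube (s : seq 'rV[R]_d) i :
    {in s, forall x, cube x} -> cube (nth 0 s i).
  move=> s_cube; have [i_lt|i_ge] := ltnP i (size s).
    exact/s_cube/mem_nth.
  by rewrite nth_default //; exact: cube0.
by move=> X_cube Q_cube v /=; case: ifP => _; exact: nth_cube.
Qed.

Lemma info_first_stage f k : (k <= size X)%N ->
  info two_stage f k = [seq f x | x <- take k X].
Proof.
elim: k => [|k IHk] kX /=; first by rewrite take0.
rewrite (IHk (ltnW kX)) size_map size_takel ?kX ?(ltnW kX) //.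
by rewrite (take_nth 0 kX) map_rcons.
Qed.

Lemma info_second_stage f k : (k <= size (Q [seq f x | x <- X]))%N ->
  info two_stage f (size X + k) =
    [seq f x | x <- X] ++ [seq f x | x <- take k (Q [seq f x | x <- X])].
Proof.
elim: k => [|k IHk] kQ.
  by rewrite addn0 info_first_stage // take_size take0 cats0.
rewrite addnS /= (IHk (ltnW kQ)) size_cat !size_map size_takel ?(ltnW kQ) //.
rewrite ltnNge leq_addr /= take_size_cat ?size_map // addKn.
by rewrite -cats1 -catA cats1 (take_nth 0 kQ) map_rcons.
Qed.

Lemma run_two_stage f N : size (Q [seq f x | x <- X]) = N ->
  run (size X + N) two_stage f =
    phi [seq f x | x <- X] [seq f x | x <- Q [seq f x | x <- X]].
Proof.
move=> <-; rewrite /run info_second_stage // take_size /=.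
by rewrite take_size_cat ?drop_size_cat ?size_map.
Qed.

End TwoStage.

Section UniformProbability.
Variables (R : realType) (n : nat).

Definition uniform_nat : set nat -> \bar R :=
  mscale (n.+1%:R^-1)%:nng (msum (fun k => \d_k) n.+1).

HB.instance Definition _ := Measure.on uniform_nat.

Lemma uniform_nat_setT : uniform_nat setT = 1%E.
Proof.
transitivity ((n.+1%:R^-1)%:E * \sum_(k < n.+1) (\d_(k : nat) setT : \bar R))%E.
  by [].
under eq_bigr do rewrite diracT.
by rewrite sumEFin sumr_const card_ord -EFinM mulVf // pnatr_eq0.
Qed.

HB.instance Definition _ :=
  Measure_isProbability.Build _ _ _ uniform_nat uniform_nat_setT.

Lemma integral_uniform_nat (g : nat -> R) : (forall k, 0 <= g k) ->
  (\int[uniform_nat]_(k in setT) (g k)%:E =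
    (n.+1%:R^-1 * \sum_(k < n.+1) g k)%:E)%E.
Proof.
move=> g_ge0; rewrite /uniform_nat ge0_integral_mscale //; last first.
  by move=> k _; rewrite lee_fin.
rewrite ge0_integral_measure_sum //; last by move=> k _; rewrite lee_fin.
rewrite EFinM; congr (_ * _)%E; rewrite -sumEFin; apply: eq_bigr => k _.
by rewrite integral_dirac // diracT mul1e.
Qed.

End UniformProbability.

Section MinimaxError.
Variables (R : realType) (d : nat) (F : set ('rV[R]_d -> R)).
Implicit Types (f g : 'rV[R]_d -> R) (X : seq 'rV[R]_d) (L delta b : R).

Lemma sigma_ad_le_mean n (Omega : finType) (S : Omega -> adaptive_alg R d) b :
  (0 < #|Omega|)%N -> (forall w, admissible (S w)) ->
  (forall f, F f -> mean (fun w => `|logpart f - run n (S w) f|) <= b) ->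
  (sigma_ad n F <= b%:E)%E.
Proof.
move=> Omega_gt0 S_adm err_le; have /card_gt0P[w0 _] := Omega_gt0.
pose S_nat k := S (nth w0 (enum Omega) k).
pose P : probability nat R := @uniform_nat R #|Omega|.-1.
apply: (@le_trans _ _ (worst_err n F P S_nat)).
  apply: ereal_inf_lbound; exists _, nat, P, S_nat.
  by split=> [k|]; [exact: S_adm|split].
apply: ge_ereal_sup => _ [f Ff <-]; rewrite integral_uniform_nat // lee_fin.
rewrite prednK //; apply: le_trans (err_le f Ff).
rewrite -(big_mkord predT (fun k => `|logpart f - run n (S_nat k) f|)).
by rewrite /mean -[index_enum _]enumT (big_nth w0) -cardE.
Qed.

Definition information_diameter_le X delta : Prop :=
  forall f g, F f -> F g -> [seq f x | x <- X] = [seq g x | x <- X] ->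
  forall x, cube x -> `|f x - g x| <= delta.

Definition interpolant X (v : seq R) : 'rV[R]_d -> R :=
  xget (cst 0) [set g | F g /\ [seq g x | x <- X] = v].

Lemma interpolantP X f : F f ->
  F (interpolant X [seq f x | x <- X]) /\
  [seq interpolant X [seq f x | x <- X] x | x <- X] = [seq f x | x <- X].
Proof.
move=> Ff; apply: (@xgetPex _ _
  [set g | F g /\ [seq g x | x <- X] = [seq f x | x <- X]]).
by exists f.
Qed.

Lemma interpolant_le X delta f : information_diameter_le X delta -> F f ->
  forall x, cube x -> `|f x - interpolant X [seq f x | x <- X] x| <= delta.
Proof.
move=> X_diam Ff; have [Fg gX] := interpolantP X Ff.
by apply: X_diam => //; rewrite gX.
Qed.

Variables (L : R) (X : seq 'rV[R]_d) (delta : R).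
Hypotheses (L_ge0 : 0 <= L) (F_lip : F `<=` coord_lipschitz L).
Hypotheses (X_cube : {in X, forall x, cube x}).
Hypothesis (X_diam : information_diameter_le X delta).

Lemma sigma_ad_interpolation_le : (sigma_ad (size X) F <= delta%:E)%E.
Proof.
pose A := two_stage X (fun _ => [::]) (fun v _ => logpart (interpolant X v)).
apply: (@sigma_ad_le_mean _ unit (fun=> A)) => [|_|f Ff].
- by rewrite card_unit.
- exact: two_stage_admissible.
rewrite mean_cst ?card_unit // -[size X]addn0 run_two_stage //.
have [Fg _] := interpolantP X Ff.
apply: logpart_lipschitz (F_lip Ff) (F_lip Fg) _ => //.
exact: interpolant_le.
Qed.

Section MonteCarlo.
Variables (N K : nat) (x : ('rV[R]_d -> R) -> K.-tuple 'rV[R]_d).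
Hypotheses (N_gt0 : (0 < N)%N) (K_gt0 : (0 < K)%N).
Hypothesis x_cube : forall g, {in x g, forall y, cube y}.

Definition monte_carlo_alg (w : {ffun 'I_N -> 'I_K}) : adaptive_alg R d :=
  two_stage X
    (fun v => [seq tnth (x (interpolant X v)) (w i) | i <- enum 'I_N])
    (fun v u => let g := interpolant X v in
      logpart g +
      ln (mean (fun i : 'I_N => expR (u`_i - g (tnth (x g) (w i)))))).

Lemma monte_carlo_admissible w : admissible (monte_carlo_alg w).
Proof.
apply: two_stage_admissible => // v _ /mapP[i _ ->].
exact/x_cube/mem_tnth.
Qed.

Lemma run_monte_carlo w f : let g := interpolant X [seq f y | y <- X] in
  run (size X + N) (monte_carlo_alg w) f =
    logpart g + ln (mean (fun i => density_ratio (x g) f g (w i))).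
Proof.
move=> g; rewrite /monte_carlo_alg run_two_stage; last first.
  by rewrite size_map size_enum_ord.
congr (_ + ln _); apply: eq_mean => i.
by rewrite -map_comp (nth_map i) ?size_enum_ord //= nth_ord_enum.
Qed.

Lemma monte_carlo_error_le eps f : F f ->
  (forall g, F g -> (forall y, cube y -> `|f y - g y| <= delta) ->
   `|logpart f - logpart g - ln (mean (density_ratio (x g) f g))| <= eps) ->
  mean (fun w => `|logpart f - run (size X + N) (monte_carlo_alg w) f|) <=
    expR (2 * delta) * (2 * delta) / Num.sqrt N%:R + eps.
Proof.
move=> Ff x_quad; set g := interpolant X [seq f y | y <- X].
have [Fg _] := interpolantP X Ff.
have fg : forall y, cube y -> `|f y - g y| <= delta by exact: interpolant_le.
have delta_ge0 : 0 <= delta := le_trans (normr_ge0 _) (fg 0 (@cube0 R d)).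
pose Z := density_ratio (x g) f g.
have Z_itv k : expR (- delta) <= Z k <= expR delta.
  by apply: density_ratio_itv => y /x_cube/fg.
have W_gt0 : (0 < #|{ffun 'I_N -> 'I_K}|)%N.
  by rewrite card_ffun !card_ord expn_gt0 K_gt0.
apply: (@le_trans _ _ (mean (fun w : {ffun 'I_N -> 'I_K} =>
    `|ln (mean Z) - ln (mean (fun i => Z (w i)))| + eps))).
  apply: le_mean => w; rewrite run_monte_carlo -/g.
  have -> (a b c : R) :
      a - (b + c) = (ln (mean Z) - c) + (a - b - ln (mean Z)) by ring.
  exact: le_trans (ler_normD _ _) (lerD (lexx _) (x_quad g Fg fg)).
rewrite meanD mean_cst // lerD2r.
have := @mean_ln_sample_dev_le R 'I_N 'I_K Z delta; rewrite !card_ord; exact.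
Qed.

End MonteCarlo.

Lemma sigma_ad_monte_carlo_le N : (0 < N)%N ->
  (sigma_ad (size X + N) F <=
    (expR (2 * delta) * (2 * delta) / Num.sqrt N%:R)%:E)%E.
Proof.
move=> N_gt0; apply/lee_addgt0Pr => eps eps_gt0; rewrite -EFinD.
have [K [x [K_gt0 x_cube x_quad]]] :=
  exists_importance_atoms d delta L_ge0 eps_gt0.
apply: (@sigma_ad_le_mean _ _ (@monte_carlo_alg N K x)) => [|w|f Ff].
- by rewrite card_ffun !card_ord expn_gt0 K_gt0.
- exact: monte_carlo_admissible.
- by apply: monte_carlo_error_le => // g Fg; apply: x_quad; exact: F_lip.
Qed.

End MinimaxError.

(** * Rates *)

Section Rates.
Variable R : realType.
Implicit Types d m n k p q : nat.

Definition power_rate m d n : R := n%:R `^ (- (m%:R / d%:R)).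

Lemma power_rate_gt0 m d n : (0 < n)%N -> 0 < power_rate m d n.
Proof. by move=> n_gt0; rewrite powR_gt0 // ltr0n. Qed.

Lemma power_rate1 m d : power_rate m d 1 = 1.
Proof. by rewrite /power_rate powR1. Qed.

Lemma power_rate_sqrt n : power_rate 1 2 n = (Num.sqrt n%:R)^-1.
Proof. by rewrite /power_rate div1r powRN powR12_sqrt. Qed.

Lemma power_rate_le m d q k n : (0 < d)%N -> (0 < k)%N -> (0 < n)%N ->
  (n <= q ^ d * k)%N -> power_rate m d k <= q%:R ^+ m * power_rate m d n.
Proof.
move=> d_gt0 k_gt0 n_gt0 n_le.
have dR_neq0 : d%:R != 0 :> R by rewrite pnatr_eq0 -lt0n.
rewrite /power_rate !powRN ler_pdivlMr ?powR_gt0 ?ltr0n //.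
rewrite mulrC ler_pdivrMr ?powR_gt0 ?ltr0n //.
have -> : q%:R ^+ m = (q%:R ^+ d) `^ (m%:R / d%:R) :> R.
  by rewrite -[_ ^+ d]powR_mulrn // -powRrM mulrCA divff // mulr1 powR_mulrn.
rewrite -powRM ?exprn_ge0 //.
rewrite ge0_ler_powR ?nnegrE ?divr_ge0 ?mulr_ge0 ?exprn_ge0 //.
by rewrite -natrX -natrM ler_nat.
Qed.

Lemma exists_root_floor d n : (0 < d)%N ->
  exists2 p, (p ^ d <= n)%N & (n < p.+1 ^ d)%N.
Proof.
move=> d_gt0.
have root_ex : exists p, (p ^ d <= n)%N by exists 0%N; rewrite exp0n.
have root_le p : (p ^ d <= n)%N -> (p <= n)%N.
  apply: leq_trans; case: p => [|p] //.
  by rewrite -{1}(expn1 p.+1) leq_pexp2l.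
case: (ex_maxnP root_ex root_le) => p p_le p_max; exists p => //.
by rewrite ltnNge; apply/negP => /p_max; rewrite ltnn.
Qed.

End Rates.

Section InformationDiameter.
Variables (R : realType) (d m : nat).
Hypotheses (d_gt0 : (0 < d)%N) (m_gt0 : (0 < m)%N).
Implicit Types (B c delta : R) (X Y : seq 'rV[R]_d).

Lemma information_diameter_leW (F : set ('rV[R]_d -> R)) X delta delta' :
  delta <= delta' -> information_diameter_le F X delta ->
  information_diameter_le F X delta'.
Proof.
move=> le_delta X_diam f g Ff Fg fg x x_cube.
by apply: le_trans le_delta; exact: X_diam.
Qed.

Lemma Fclass_information_diameter_bound B X :
  information_diameter_le (@Fclass R d m B) X (2 * B).
Proof.
move=> f g [_ f_le] [_ g_le] _ x x_cube; apply: le_trans (ler_normB _ _) _.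
by rewrite mulr2n mulrDl mul1r lerD ?(f_le [::]) ?(g_le [::]).
Qed.

Lemma Fclass_information_diameter_grid B p Y : (m <= p)%N ->
  information_diameter_le (@Fclass R d m B) (grid p d 0 ++ Y)
    (interpolation_const R m d * (2 * B * (m%:R / p%:R) ^+ m)).
Proof.
move=> mp f g Ff Fg fg x; apply: eq_on_grid_le => // y y_grid.
move: fg; rewrite !map_cat => /eqP.
rewrite eqseq_cat ?size_map // => /andP[/eqP fg _].
by apply/eq_in_map: y y_grid.
Qed.

Lemma grid_diameter_le B p r : 0 <= B -> (0 < p)%N ->
  1 <= (2 * p)%:R ^+ m * r ->
  interpolation_const R m d * (2 * B * (m%:R / p%:R) ^+ m) <=
    interpolation_const R m d * (2 * m%:R ^+ m * 2 ^+ m) * (B * r).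
Proof.
move=> B_ge0 p_gt0; rewrite natrM exprMn => r_ge.
have pm_gt0 : 0 < p%:R ^+ m :> R by rewrite exprn_gt0 // ltr0n.
have invp_le : (p%:R ^+ m)^-1 <= 2 ^+ m * r.
  by rewrite -[leLHS]mul1r ler_pdivrMr // mulrAC.
rewrite -!mulrA ler_wpM2l ?interpolation_const_ge0 // ler_wpM2l //.
rewrite exprMn exprVn mulrCA ler_wpM2l ?exprn_ge0 // [leRHS]mulrCA.
by rewrite ler_wpM2l.
Qed.

Definition Fclass_diameter_rate c : Prop := forall n, (0 < n)%N ->
  exists X : seq 'rV[R]_d, [/\ size X = n, {in X, forall x, cube x} &
    forall B, 0 <= B ->
    information_diameter_le (Fclass m B) X (c * B * power_rate R m d n)].

Lemma exists_Fclass_diameter_rate : exists2 c, 0 < c & Fclass_diameter_rate c.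
Proof.
pose fine_const : R := interpolation_const R m d * (2 * m%:R ^+ m * 2 ^+ m).
pose coarse_const : R := 2 * m%:R ^+ m.
have fine_ge0 : 0 <= fine_const.
  by rewrite !mulr_ge0 ?exprn_ge0 ?interpolation_const_ge0.
have coarse_gt0 : 0 < coarse_const by rewrite mulr_gt0 // exprn_gt0 // ltr0n.
exists (fine_const + coarse_const) => [|n n_gt0]; first by rewrite ltr_wpDl.
have [p p_le p_gt] := exists_root_floor n d_gt0.
have r_ge0 := ltW (power_rate_gt0 R m d n_gt0).
set r := power_rate R m d n in r_ge0 *.
have one_le q : (n <= q ^ d)%N -> 1 <= q%:R ^+ m * r.
  move=> n_le; have := @power_rate_le R m d q 1 n d_gt0 isT n_gt0.
  by rewrite power_rate1 muln1; apply.
exists (grid p d 0 ++ nseq (n - p ^ d) 0); split=> [|x|B B_ge0].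
- by rewrite size_cat size_grid size_nseq subnKC.
- rewrite mem_cat => /orP[/grid_cube|]; first by apply; exact: cube0.
  by rewrite mem_nseq => /andP[_ /eqP ->]; exact: cube0.
have Br_ge0 : 0 <= B * r by rewrite mulr_ge0.
rewrite -mulrA; have [mp|pm] := leqP m p; last first.
  have m_root : (n <= m ^ d)%N by rewrite (leq_trans (ltnW p_gt)) // leq_exp2r.
  apply: information_diameter_leW (@Fclass_information_diameter_bound B _).
  have := ler_wpM2l B_ge0 (one_le m m_root); have := mulr_ge0 fine_ge0 Br_ge0.
  by rewrite /coarse_const; nra.
have p_gt0 : (0 < p)%N := leq_trans m_gt0 mp.
have double_root : (n <= (2 * p) ^ d)%N.
  by rewrite (leq_trans (ltnW p_gt)) // leq_exp2r //; lia.
apply: information_diameter_leW (@Fclass_information_diameter_grid B p _ mp).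
apply: le_trans (grid_diameter_le B_ge0 p_gt0 (one_le _ double_root)) _.
by rewrite ler_wpM2r // lerDl ltW.
Qed.

End InformationDiameter.

Section FclassMinimax.
Variables (R : realType) (d m : nat) (c : R).
Hypotheses (d_gt0 : (0 < d)%N) (m_gt0 : (0 < m)%N) (c_gt0 : 0 < c).
Hypothesis c_rate : Fclass_diameter_rate d m c.
Variables (B : R) (n : nat).
Hypotheses (B_gt0 : 0 < B) (n_gt0 : (0 < n)%N).
Local Notation r := (power_rate R m d n).
Local Notation delta := (2 ^+ m * (c * B * r)).

Lemma sigma_ad_Fclass_interpolation_le :
  (sigma_ad n (@Fclass R d m B) <= (c * B * r)%:E)%E.
Proof.
have [X [<- X_cube X_diam]] := c_rate n_gt0.
apply: (@sigma_ad_interpolation_le _ _ _ B) => //; first exact: ltW.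
  by move=> f; exact: Fclass_coord_lipschitz.
exact/X_diam/ltW.
Qed.

Lemma sigma_ad_Fclass_monte_carlo_le :
  (sigma_ad n (@Fclass R d m B) <=
    (expR (2 * delta) * (4 * delta) / Num.sqrt n%:R)%:E)%E.
Proof.
have cB_ge0 : 0 <= c * B by rewrite mulr_ge0 ?ltW.
have cBr_ge0 : 0 <= c * B * r by rewrite mulr_ge0 // ltW // power_rate_gt0.
have delta_ge : c * B * r <= delta by rewrite ler_peMl // exprn_ege1 // ler1n.
have delta_ge0 := le_trans cBr_ge0 delta_ge.
have [n_le1|n_gt1] := leqP n 1.
  apply: le_trans sigma_ad_Fclass_interpolation_le _.
  have -> : Num.sqrt n%:R = 1 :> R by rewrite (_ : n = 1%N) ?sqrtr1 //; lia.
  rewrite lee_fin divr1; apply: le_trans delta_ge _.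
  have expR_ge1 : 1 <= expR (2 * delta) by have := expR_ge1Dx (2 * delta); lra.
  by apply: (@le_trans _ _ (4 * delta)); [lra|rewrite ler_peMl //; lra].
have [half_gt0 rest_gt0] : (0 < n./2)%N /\ (0 < n - n./2)%N by split; lia.
have [X [X_size X_cube X_diam]] := c_rate rest_gt0.
have delta_diam : information_diameter_le (Fclass m B) X delta.
  apply: information_diameter_leW (X_diam B (ltW B_gt0)).
  rewrite mulrCA ler_wpM2l //; apply: (@power_rate_le R m d 2) => //.
  apply: (@leq_trans (2 ^ 1 * (n - n./2))); first by lia.
  by rewrite leq_mul2r leq_pexp2l ?orbT.
have sampling_rate : (Num.sqrt (n./2)%:R)^-1 <= 2 * (Num.sqrt n%:R)^-1 :> R.
  by rewrite -!power_rate_sqrt; apply: (@power_rate_le _ 1 2 2) => //; lia.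
have n_split : (size X + n./2)%N = n by rewrite X_size; lia.
have F_lip : @Fclass R d m B `<=` @coord_lipschitz R d B.
  by move=> f; exact: Fclass_coord_lipschitz.
have := sigma_ad_monte_carlo_le (ltW B_gt0) F_lip X_cube delta_diam half_gt0.
rewrite n_split => /le_trans; apply.
rewrite lee_fin -[leLHS]mulrA -[leRHS]mulrA.
have -> : 4 * delta / Num.sqrt n%:R = 2 * delta * (2 / Num.sqrt n%:R) by ring.
by rewrite ler_wpM2l ?expR_ge0 // ler_wpM2l // mulr_ge0.
Qed.

End FclassMinimax.

Theorem theorem6 (R : realType) (d m : nat) :
  (1 <= d)%N -> (1 <= m)%N ->
  exists C C' : R, 0 < C /\ 0 < C' /\
    forall (B : R) (n : nat), 0 < B -> (1 <= n)%N ->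
      let r := n%:R `^ (- (m%:R / d%:R)) in
      (sigma_ad n (@Fclass R d m B) <=
        (C' * Num.min (B * r)
                      (expR (C * B * r) * B * (n%:R `^ (- (2%:R)^-1)) * r))%:E)%E.
Proof.
move=> d_gt0 m_gt0.
have [c c_gt0 c_rate] := exists_Fclass_diameter_rate R d_gt0 m_gt0.
have pow2_ge1 : 1 <= 2 ^+ m :> R by rewrite exprn_ege1 // ler1n.
have c_le : c <= 4 * (2 ^+ m * c) by nra.
exists (2 * (2 ^+ m * c)), (4 * (2 ^+ m * c)); do 2?[split; first by lra].
move=> B n B_gt0 n_gt0 /=.
rewrite -/(power_rate R m d n); set r := power_rate R m d n.
have Br_ge0 : 0 <= B * r by rewrite mulr_ge0 ?ltW ?power_rate_gt0.
rewrite minEle; case: ifP => _.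
  apply: le_trans (sigma_ad_Fclass_interpolation_le m_gt0 c_rate B_gt0 n_gt0) _.
  by rewrite lee_fin -mulrA ler_wpM2r.
apply: le_trans
  (sigma_ad_Fclass_monte_carlo_le d_gt0 m_gt0 c_gt0 c_rate B_gt0 n_gt0) _.
rewrite lee_fin powRN powR12_sqrt // -/r.
rewrite [X in _ <= X](_ : _ = expR (2 * (2 ^+ m * (c * B * r))) *
  (4 * (2 ^+ m * (c * B * r))) / Num.sqrt n%:R) //.
rewrite (_ : 2 * (2 ^+ m * c) * B * r = 2 * (2 ^+ m * (c * B * r))); ring.
Qed.
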